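(* Let $\alpha,\beta \geq 0$. Suppose that $X$ is a compact subset of a Banach space $\mathfrak{B}$ such that $X-X$ is $(\alpha,\beta)$-almost homogeneous at the origin. Then, given any $\delta > \frac{1+\alpha+\beta}{2}$, there exist a Hilbert space $H$ and a bounded linear map $\Phi \colon \mathfrak{B} \to H$ that satisfies $$\frac{1}{C_\Phi}\,\frac{\|x-y\|}{\mathrm{slog}(\|x-y\|)^{\delta}} \leq \|\Phi(x)-\Phi(y)\| \leq \|x-y\|$$ for some positive constant $C_\Phi$ and for every $x,y\in X$ with $x \neq y$.
   Context: Banach and Hilbert spaces are real. The symmetric logarithm is $\mathrm{slog}(x) = \log\left(x + \frac1x\right)$ for $x>0$. For a subset $X$ of a normed space, $X-X = \{x-y : x,y\in X\}$, and $B_r(z)$ denotes the closed ball of radius $r$ centred at $z$. For $M>0$, $s>0$, $\alpha,\beta\ge 0$, the set $X-X$ is called $(\alpha,\beta)$-almost $(M,s)$-homogeneous at the origin if for all $0<\rho<r$ there exist finitely many points $z_1,\dots,z_K \in X-X$ such that $$B_r(0)\cap (X-X) \subseteq \bigcup_{i=1}^K B_\rho(z_i), \qquad K \leq M\left(\frac{r}{\rho}\right)^{s} \mathrm{slog}(r)^{\alpha}\,\mathrm{slog}(\rho)^{\beta}.$$ It is called $(\alpha,\beta)$-almost homogeneous at the origin if this holds for some $M>0$ and $s>0$. *)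

(* Defs.v *)
From mathcomp Require Import all_boot all_order all_algebra.
From mathcomp Require Import sesquilinear.
From mathcomp Require Import all_classical all_reals all_analysis.

Set Implicit Arguments.
Unset Strict Implicit.
Unset Printing Implicit Defensive.

Import Order.TTheory GRing.Theory Num.Theory.
Import numFieldNormedType.Exports.

Local Open Scope classical_set_scope.
Local Open Scope ring_scope.

Definition slog (R : realType) (x : R) : R := ln (x + x^-1).

Definition difference_set (R : realType) (V : normedModType R) (X : set V) :
    set V :=
  [set x - y | x in X & y in X].

Definition almost_Ms_homogeneous_at0 (R : realType) (V : normedModType R)
    (alpha beta M s : R) (Z : set V) : Prop :=
  forall r rho : R, 0 < rho -> rho < r ->
    exists (K : nat) (z : 'I_K -> V),
      [/\ forall i, Z (z i),
          closed_ball_ Num.norm 0 r `&` Z `<=`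
            \bigcup_i closed_ball_ Num.norm (z i) rho
        & K%:R <=
            M * (r / rho) `^ s * slog r `^ alpha * slog rho `^ beta].

Definition almost_homogeneous_at0 (R : realType) (V : normedModType R)
    (alpha beta : R) (Z : set V) : Prop :=
  exists M s : R,
    [/\ 0 < M, 0 < s & almost_Ms_homogeneous_at0 alpha beta M s Z].

(* A real Hilbert space is a Banach space whose norm is induced by an inner
   product; [{dot H for idfun}] is the type of positive definite symmetric
   bilinear forms on [H]. *)
Definition is_hilbert (R : realType) (H : completeNormedModType R) : Prop :=
  exists dot : {dot H for idfun}, forall x : H, dot x x = `|x| ^+ 2.

Definition bounded_linear (R : realType) (V W : normedModType R)
    (f : {linear V -> W}) : Prop :=
  exists C : R, forall x : V, `|f x| <= C * `|x|.

(* Main.v *)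
Require Import Defs.
From HB Require Import structures.
From mathcomp Require Import all_boot all_order all_algebra.
From mathcomp Require Import sesquilinear lra ring.
From mathcomp Require Import all_classical all_reals all_analysis.

Import Order.TTheory GRing.Theory Num.Theory.
Import numFieldNormedType.Exports.

Local Open Scope classical_set_scope.
Local Open Scope ring_scope.

(* Cut [X - X] into the dyadic annuli [D / 2 ^+ k.+1 < `|z| <= D / 2 ^+ k] and
   cover the [k]-th ball by [K k] balls of an eighth of its radius; almost
   homogeneity gives [K k = O(k `^ (alpha + beta))].  A norming functional of
   the centre closest to [z] is at least [`|z| / 2] at [z].  Send [x] to the
   square-summable family of the values at [x] of all these functionals, those
   of the [k]-th annulus being weighted by [sqrt (a k / K k)] with
   [\sum_k a k <= 1] and [a k] of order [k `^ (- q - 1)].  The map is a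
   contraction, and on the [k]-th annulus, where [slog `|z|] is of order [k],
   it shrinks [z] by at most a factor of order
   [k `^ - ((q + 1 + alpha + beta) / 2)]; choose [q] so that this exponent is
   [- delta]. *)

(** * Norming functionals *)

Section Sublinear.
Context {R : realType} {V : lmodType R}.
Implicit Types (q : V -> R) (x y : V).

(** Homogeneity is asked only as an inequality at positive [t], a form that passes to infima;
    [sublinearZ] recovers equality for all [t >= 0]. *)
Definition sublinear q :=
  (forall x y, q (x + y) <= q x + q y) /\
  (forall (t : R) x, 0 < t -> q (t *: x) <= t * q x).

(** The reverse inequality is the given one at [t^-1] and [t *: x]. At [t = 0], the factor [2^-1]
    forces [q 0 <= 0] and subadditivity forces [0 <= q 0]. *)
Lemma sublinearZ q (t : R) x : sublinear q -> 0 <= t -> q (t *: x) = t * q x.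
Proof.
move=> [qD qZ]; rewrite le_eqVlt => /orP[/eqP <-|t0].
  rewrite scale0r mul0r; apply/eqP; rewrite eq_le; apply/andP; split.
    have := qZ 2^-1 0; rewrite scaler0 invr_gt0 ltr0n => /(_ isT); lra.
  by have := qD 0 0; rewrite addr0; lra.
apply/eqP; rewrite eq_le qZ//= -ler_pdivlMl//.
have := qZ t^-1 (t *: x); rewrite scalerA mulVf ?gt_eqF// scale1r.
by apply; rewrite invr_gt0.
Qed.

Lemma sublinear_ge q x : sublinear q -> - q (- x) <= q x.
Proof.
move=> sq; have := sq.1 x (- x); rewrite subrr.
by have := sublinearZ _ 0 0 sq (lexx 0); rewrite scale0r mul0r => ->; lra.
Qed.

Lemma le_inf_add (A B : set R) (c : R) : A !=set0 -> B !=set0 ->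
  (forall a b, A a -> B b -> c <= a + b) -> c <= inf A + inf B.
Proof.
move=> A0 B0 cAB; rewrite -lerBlDr; apply: lb_le_inf => // a Aa.
rewrite lerBlDr -lerBlDl; apply: lb_le_inf => // b Bb.
by rewrite lerBlDl cAB.
Qed.

(** For sublinear [q], this is the largest sublinear minorant of [q] whose value at [- y] is at most
    [- q y]. *)
Definition sublinear_at q y x : R :=
  inf [set q (x + t *: y) - t * q y | t in [set t | 0 <= t]].

Lemma sublinear_at_le q y x (t : R) : sublinear q -> 0 <= t ->
  sublinear_at q y x <= q (x + t *: y) - t * q y.
Proof.
move=> sq t0; apply: ge_inf; last by exists t.
(* The set is bounded below because [q (u *: y) <= q (x + u *: y) + q (- x)]. *)
exists (- q (- x)) => _ [u u0 <-]; rewrite -(sublinearZ q u y sq u0).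
by have := sq.1 (x + u *: y) (- x); rewrite addrC addKr; lra.
Qed.

(** Parameters [t] at [x] and [u] at [x'] combine to [t + u] at [x + x']; the parameter [t] at [x]
    becomes [c * t] at [c *: x]. *)
Lemma sublinear_at_sublinear q y : sublinear q -> sublinear (sublinear_at q y).
Proof.
move=> sq; split=> [x x'|c x c0].
  apply: le_inf_add; [by exists (q (x + 0 *: y) - 0 * q y), 0 => /=|
    by exists (q (x' + 0 *: y) - 0 * q y), 0 => /=|].
  move=> _ _ [t t0 <-] [u u0 <-].
  apply: le_trans (sublinear_at_le _ y _ (t + u) sq (addr_ge0 t0 u0)) _.
  have := sq.1 (x + t *: y) (x' + u *: y).
  by rewrite addrACA -scalerDl; lra.
rewrite -ler_pdivrMl//; apply: lb_le_inf.
  by exists (q (x + 0 *: y) - 0 * q y), 0 => /=.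
move=> _ [t t0 <-]; rewrite ler_pdivrMl//.
have ct0 : 0 <= c * t by rewrite mulr_ge0// ltW.
apply: le_trans (sublinear_at_le _ y _ _ sq ct0) _.
by rewrite -scalerA -scalerDr (sublinearZ _ _ _ sq (ltW c0)); lra.
Qed.

Lemma sublinear_at_le_self q y x : sublinear q -> sublinear_at q y x <= q x.
Proof.
move=> sq; have := sublinear_at_le _ y x _ sq (lexx 0).
by rewrite scale0r mul0r addr0 subr0.
Qed.

(* By minimality [sublinear_at q y = q], and [t = 1] in the infimum then gives
   [q x + q y <= q (x + y)]. *)
Lemma minimal_sublinear_scalar q : sublinear q ->
  (forall p, sublinear p -> (forall x, p x <= q x) -> p = q) -> scalar q.
Proof.
move=> sq qmin.
have qD x y : q (x + y) = q x + q y.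
  apply/eqP; rewrite eq_le sq.1/=.
  have := sublinear_at_le _ y x _ sq ler01.
  rewrite (qmin _ (sublinear_at_sublinear _ y sq)
    (fun x => sublinear_at_le_self _ y x sq)) scale1r mul1r; lra.
have qN x : q (- x) = - q x.
  have := qD x (- x); rewrite subrr.
  by have := sublinearZ _ 0 0 sq (lexx 0); rewrite scale0r mul0r => ->; lra.
move=> a x y; rewrite qD; congr (_ + _).
have [a0|/ltW a0] := leP 0 a; first exact: sublinearZ.
by rewrite -{1}[a]opprK scaleNr qN sublinearZ ?oppr_ge0 ?mulNr ?opprK.
Qed.

(** Zorn's lemma for the reversed pointwise order on the sublinear functionals below [p]. A nonempty
    chain is bounded by its pointwise infimum, finite because [- p (- x) <= - q (- x) <= q x]. *)
Lemma exists_minimal_sublinear p : sublinear p ->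
  exists q, [/\ sublinear q, forall x, q x <= p x &
    forall q', sublinear q' -> (forall x, q' x <= q x) -> q' = q].
Proof.
move=> sp; pose P q := sublinear q /\ forall x, q x <= p x.
pose T := {q | P q}.
pose rle (q1 q2 : T) := `[< forall x, sval q2 x <= sval q1 x >].
have [| | | |[q [sq qp]] qmin] := @Zorn T rle.
- by move=> q; apply/asboolP => x.
- by move=> q1 q2 q3 /asboolP h12 /asboolP h23; apply/asboolP => x;
    exact: le_trans (h12 x).
- move=> [q1 P1] [q2 P2] /asboolP /= h12 /asboolP /= h21.
  by apply: eq_exist; apply/funext => x; apply/eqP; rewrite eq_le h12 h21.
- move=> A totA.
  have [->|/set0P[q0 Aq0]] := eqVneq A set0.
    by exists (exist P p (conj sp (fun x => lexx (p x)))).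
  pose E x := [set sval q x | q in A].
  have E0 x : E x !=set0 by exists (sval q0 x), q0.
  have infE (q : T) x : A q -> inf (E x) <= sval q x.
    move=> Aq; apply: ge_inf; last by exists q.
    exists (- p (- x)) => _ [q' Aq' <-].
    apply: le_trans (sublinear_ge _ _ (svalP q').1).
    by rewrite lerN2 (svalP q').2.
  have Pinf : P (fun x => inf (E x)).
    split; last by move=> x; apply: le_trans (infE _ x Aq0) ((svalP q0).2 x).
    split=> [x y|t x t0].
      apply: le_inf_add => // _ _ [q1 Aq1 <-] [q2 Aq2 <-].
      (* The values at [x] and at [y] come from two members of the chain; the pointwise smaller of
         them serves at both points. *)
      have [/asboolP h|/asboolP h] := totA _ _ Aq1 Aq2.
        apply: le_trans (infE _ _ Aq2) _.
        by apply: le_trans ((svalP q2).1.1 x y) _; rewrite lerD2r.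
      apply: le_trans (infE _ _ Aq1) _.
      by apply: le_trans ((svalP q1).1.1 x y) _; rewrite lerD2l.
    rewrite -ler_pdivrMl//; apply: lb_le_inf => // _ [q Aq <-].
    rewrite ler_pdivrMl//; apply: le_trans (infE _ _ Aq) _.
    exact: (svalP q).1.2.
  by exists (exist P _ Pinf) => q Aq; apply/asboolP => x /=; exact: infE.
exists q; split=> // q' sq' q'q.
have Pq' : P q' by split=> // x; exact: le_trans (q'q x) (qp x).
have /(_ _)/(congr1 sval) := qmin (exist P q' Pq').
by apply; apply/asboolP.
Qed.

End Sublinear.

(* Any linear functional below [sublinear_at norm z] is below the norm, and
   takes a value [<= - `|z|] at [- z] (choose [t = 1] in the infimum). *)
Lemma norming_functional {R : realType} {V : normedModType R} (z : V) :
  exists f : {scalar V}, (forall x, `|f x| <= `|x|) /\ f z = `|z|.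
Proof.
have snorm : sublinear (fun x : V => `|x|).
  by split=> [|t x t0]; [exact: ler_normD|rewrite normrZ gtr0_norm].
have [q [sq qp qmin]] :=
  exists_minimal_sublinear _ (sublinear_at_sublinear _ z snorm).
have qn x : q x <= `|x| := le_trans (qp x) (sublinear_at_le_self _ z x snorm).
have linq := minimal_sublinear_scalar _ sq qmin.
pose f : {scalar V} := HB.pack q (GRing.isLinear.Build R V R _ q linq).
have fn x : `|f x| <= `|x|.
  rewrite ler_norml qn andbT lerNl -[- f x]linearN.
  by apply: le_trans (qn _) _; rewrite normrN.
exists f; split=> //; apply/eqP; rewrite eq_le qn/=.
have := le_trans (qp (- z)) (sublinear_at_le _ z (- z) _ snorm ler01).
by rewrite scale1r addNr normr0 mul1r sub0r -[q _]/(f _) linearN lerN2.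
Qed.

(** * The Hilbert space of square-summable sequences *)

Section Ell2.
Context {R : realType}.
Implicit Types u v w : nat -> R.

Lemma bounded_series_cvg u (M : R) : (forall n, 0 <= u n) ->
  (forall N, \sum_(0 <= n < N) u n <= M) -> cvgn (series u).
Proof.
move=> u0 uM; apply: nondecreasing_is_cvgn.
  by apply/nondecreasing_seqP => n; rewrite /series/= big_nat_recr//= lerDl.
by exists M => _ [N _ <-]; exact: uM.
Qed.

Lemma cvg_series_ub u N : (forall n, 0 <= u n) -> cvgn (series u) ->
  \sum_(0 <= n < N) u n <= limn (series u).
Proof.
move=> u0 cu; have := nondecreasing_cvgn_le _ cu N; apply.
by apply/nondecreasing_seqP => n; rewrite /series/= big_nat_recr//= lerDl.
Qed.

Definition ell2_pred : {pred (nat -> R)} :=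
  fun u => `[< cvgn (series (fun n => u n ^+ 2)) >].

Lemma ell2_predP u (M : R) :
  (forall N, \sum_(0 <= n < N) u n ^+ 2 <= M) -> u \in ell2_pred.
Proof.
by move=> uM; apply/asboolP; apply: bounded_series_cvg uM => n; exact: sqr_ge0.
Qed.

Lemma ell2_ub u N : u \in ell2_pred ->
  \sum_(0 <= n < N) u n ^+ 2 <= limn (series (fun n => u n ^+ 2)).
Proof. by move=> /asboolP; apply: cvg_series_ub => n; exact: sqr_ge0. Qed.

Lemma ell2_submod_closed : submod_closed ell2_pred.
Proof.
split=> [|a u v uP vP].
  by apply: (@ell2_predP _ 0) => N; rewrite big1// => n _; rewrite expr0n.
pose U := limn (series (fun n => u n ^+ 2)).
pose W := limn (series (fun n => v n ^+ 2)).
apply: (@ell2_predP _ (2 * a ^+ 2 * U + 2 * W)) => N.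
apply: (@le_trans _ _ (\sum_(0 <= n < N)
    (2 * a ^+ 2 * u n ^+ 2 + 2 * v n ^+ 2))).
  apply: ler_sum => n _.
  have -> : (a *: u + v) n = a * u n + v n by [].
  by have := sqr_ge0 (a * u n - v n); lra.
rewrite big_split/= -!mulr_sumr lerD//.
  by rewrite ler_wpM2l ?ell2_ub// mulr_ge0// sqr_ge0.
by rewrite ler_wpM2l// ell2_ub.
Qed.

HB.instance Definition _ :=
  GRing.isSubmodClosed.Build R (nat -> R) ell2_pred ell2_submod_closed.

End Ell2.

Record ell2 (R : realType) := Ell2 {
  ell2_val :> nat -> R ;
  ell2P : ell2_val \in ell2_pred }.

Section Ell2Lmodule.
Context {R : realType}.

HB.instance Definition _ := [isSub for @ell2_val R].
HB.instance Definition _ := [Choice of ell2 R by <:].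
HB.instance Definition _ := [SubChoice_isSubLmodule of ell2 R by <:].

End Ell2Lmodule.

Section Ell2Dot.
Context {R : realType}.
Implicit Types u v w : ell2 R.

Definition ell2_dot u v : R := limn (series (fun n => u n * v n)).

Lemma ell2_dot_cvg u v : cvgn (series (fun n => u n * v n)).
Proof.
apply: normed_cvg; pose U (w : ell2 R) := limn (series (fun n => w n ^+ 2)).
apply: (@bounded_series_cvg _ (fun n => `|u n * v n|) (U u + U v)) => // N.
apply: (@le_trans _ _ (\sum_(0 <= n < N) (u n ^+ 2 + v n ^+ 2))).
  apply: ler_sum => n _; rewrite normrM.
  have := sqr_ge0 (`|u n| - `|v n|).
  have := real_normK (num_real (u n)); have := real_normK (num_real (v n)).
  by have := sqr_ge0 (`|u n| + `|v n|); lra.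
by rewrite big_split/= lerD// ell2_ub// ell2P.
Qed.

Lemma ell2_dotC u v : ell2_dot u v = ell2_dot v u.
Proof.
by rewrite /ell2_dot; under eq_fun do rewrite mulrC.
Qed.

Lemma ell2_dotDl w u v : ell2_dot (u + v) w = ell2_dot u w + ell2_dot v w.
Proof.
rewrite /ell2_dot -lim_seriesD; try exact: ell2_dot_cvg.
by congr (limn (series _)); apply/funext => n /=; rewrite -mulrDl.
Qed.

Lemma ell2_dotZl w (a : R) u : ell2_dot (a *: u) w = a * ell2_dot u w.
Proof.
rewrite /ell2_dot -[RHS]lim_seriesZ; last exact: ell2_dot_cvg.
by congr (limn (series _)); apply/funext => n; exact/esym/mulrA.
Qed.

Lemma ell2_dotBl w : zmod_morphism (ell2_dot ^~ w).
Proof.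
by move=> u v /=; rewrite ell2_dotDl -scaleN1r ell2_dotZl mulN1r.
Qed.

Lemma ell2_dotBr w : zmod_morphism (ell2_dot w).
Proof. by move=> u v; rewrite !(ell2_dotC w) ell2_dotBl. Qed.

Lemma ell2_dotZr w : scalable_for (idfun \; *%R) (ell2_dot w).
Proof. by move=> a u; rewrite !(ell2_dotC w) ell2_dotZl. Qed.

Lemma ell2_dot_ub u N : \sum_(0 <= n < N) u n ^+ 2 <= ell2_dot u u.
Proof.
rewrite /ell2_dot; under [X in series X]eq_fun do rewrite -expr2.
exact/ell2_ub/ell2P.
Qed.

Lemma ell2_dot_le u (M : R) :
  (forall N, \sum_(0 <= n < N) u n ^+ 2 <= M) -> ell2_dot u u <= M.
Proof.
move=> uM; apply: limr_le; first exact: ell2_dot_cvg.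
by apply: nearW => N; apply: le_trans (uM N); apply: ler_sum.
Qed.

Lemma ell2_sqr_le u n : u n ^+ 2 <= ell2_dot u u.
Proof.
apply: le_trans (ell2_dot_ub u n.+1); rewrite big_nat_recr//= lerDr.
by apply: sumr_ge0 => i _; exact: sqr_ge0.
Qed.

Lemma ell2_dot_ge0 u : 0 <= ell2_dot u u.
Proof. exact: le_trans (sqr_ge0 _) (ell2_sqr_le u 0). Qed.

Lemma ell2_dot_eq0 u : ell2_dot u u = 0 -> u = 0.
Proof.
move=> u0; apply/val_inj/funext => n /=; apply/eqP.
by rewrite -sqrf_eq0 eq_le sqr_ge0 andbT -u0 ell2_sqr_le.
Qed.

Lemma ell2_dot_gt0 u : u != 0 -> 0 < ell2_dot u u.
Proof.
move=> u0; rewrite lt_def ell2_dot_ge0 andbT.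
by apply: contraNneq u0 => /ell2_dot_eq0 ->.
Qed.

HB.instance Definition _ := isBilinear.Build R (ell2 R) (ell2 R) R *%R
  (idfun \; *%R) ell2_dot ell2_dotBl ell2_dotBr (fun w => ell2_dotZl w)
  ell2_dotZr.

Lemma ell2_dot_hermitian u v : ell2_dot u v = (-1) ^+ false * ell2_dot v u.
Proof. by rewrite mul1r ell2_dotC. Qed.

HB.instance Definition _ := isHermitianSesquilinear.Build R (ell2 R) false
  idfun ell2_dot ell2_dot_hermitian.
HB.instance Definition _ := isDotProduct.Build R (ell2 R)
  ell2_dot ell2_dot_gt0.

Definition ell2_norm u := Num.sqrt (ell2_dot u u).

Lemma ell2_cauchy_schwarz u v :
  ell2_dot u v <= ell2_norm u * ell2_norm v.
Proof.
have [->|v0] := eqVneq v 0.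
  by rewrite ell2_dotC -(scale0r (0 : ell2 R)) ell2_dotZl mul0r mulr_ge0 ?sqrtr_ge0.
have vv := ell2_dot_gt0 _ v0.
apply: le_trans (ler_norm _) _.
rewrite -sqrtr_sqr /ell2_norm -sqrtrM ?ell2_dot_ge0// ler_wsqrtr//.
set t := ell2_dot u v; set a := ell2_dot u u; set b := ell2_dot v v.
(* This vector is [b] times the component of [u] orthogonal to [v]; its square is
   [b * (a * b - t ^+ 2)]. *)
have := ell2_dot_ge0 (b *: u - t *: v).
rewrite ell2_dotBl !ell2_dotBr !ell2_dotZl !ell2_dotZr /= (ell2_dotC v u).
rewrite -/t -/a -/b => h.
have : 0 <= b * (a * b - t ^+ 2) by lra.
by rewrite pmulr_rge0// subr_ge0.
Qed.

Lemma ell2_normD u v : ell2_norm (u + v) <= ell2_norm u + ell2_norm v.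
Proof.
have n0 w : 0 <= ell2_norm w by exact: sqrtr_ge0.
rewrite -(@ler_pXn2r _ 2)// ?nnegrE ?addr_ge0//.
rewrite sqrrD !sqr_sqrtr ?ell2_dot_ge0//.
rewrite ell2_dotDl !(ell2_dotC _ (u + v)) !ell2_dotDl (ell2_dotC v u).
by have := ell2_cauchy_schwarz u v; lra.
Qed.

Lemma ell2_normZ (a : R) u : ell2_norm (a *: u) = `|a| * ell2_norm u.
Proof.
rewrite /ell2_norm ell2_dotZl ell2_dotZr /= mulrA -expr2 sqrtrM ?sqr_ge0//.
by rewrite sqrtr_sqr.
Qed.

Lemma ell2_norm_eq0 u : ell2_norm u = 0 -> u = 0.
Proof.
move=> /eqP; rewrite sqrtr_eq0 => u0; apply: ell2_dot_eq0.
by apply/eqP; rewrite eq_le u0 ell2_dot_ge0.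
Qed.

HB.instance Definition _ := Lmodule_isNormed.Build R (ell2 R)
  ell2_normD ell2_normZ ell2_norm_eq0.

Lemma ell2_normE u : `|u| ^+ 2 = ell2_dot u u.
Proof. by rewrite sqr_sqrtr// ell2_dot_ge0. Qed.

Lemma ell2_coord_le u n : `|u n| <= `|u|.
Proof.
by rewrite -(@ler_pXn2r _ 2)// ?nnegrE// real_normK ?num_real// ell2_normE
  ell2_sqr_le.
Qed.

(** The limit [a] is taken coordinatewise. The Cauchy bound on each finite partial sum survives this
    limit and does not depend on the number of terms, so it bounds the full norm. *)
Lemma ell2_complete (F : set_system (ell2 R)) :
  ProperFilter F -> cauchy F -> cvg F.
Proof.
move=> FF /cauchyP Fc.
have cF n : cvg ((fun u : ell2 R => u n) @ F).
  apply/cauchy_cvgP/cauchyP => e e0; have [u Fu] := Fc _ e0.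
  exists (u n); rewrite nbhs_simpl /=; apply: filterS Fu => v.
  rewrite -!ball_normE/= => uv; apply: le_lt_trans uv.
  exact: (ell2_coord_le (u - v) n).
pose a n : R := lim ((fun u : ell2 R => u n) @ F).
have cvgS (u : ell2 R) N : (fun w : ell2 R => \sum_(0 <= n < N) (u n - w n) ^+ 2) @ F
    --> \sum_(0 <= n < N) (u n - a n) ^+ 2.
  elim: N => [|N IH].
    rewrite big_geq//; under eq_fun do rewrite big_geq//; exact: cvg_cst.
  rewrite big_nat_recr//=; under eq_fun do rewrite big_nat_recr//=.
  apply: cvgD => //; under eq_fun do rewrite expr2.
  by rewrite expr2; apply: cvgM; apply: cvgB; [exact: cvg_cst|exact: cF
    |exact: cvg_cst|exact: cF].
have near_a u e : F (ball u e) ->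
    forall N, \sum_(0 <= n < N) (u n - a n) ^+ 2 <= e ^+ 2.
  move=> Fu N; rewrite -(cvg_lim _ (cvgS u N))//.
  apply: limr_le; first by apply/cvg_ex; eexists; exact: cvgS.
  apply: filterS Fu => v; rewrite -ball_normE/= => /ltW uv.
  apply: le_trans (ell2_dot_ub (u - v) N) _.
  by rewrite -ell2_normE ler_pXn2r// nnegrE// (le_trans _ uv).
have [u0 Fu0] := Fc _ ltr01.
(* It is [u0 - a] that [near_a] shows to be square-summable; [a] itself is then recovered in the
   space as [u0 - d]. *)
pose d : ell2 R := Ell2 R (fun n => u0 n - a n)
  (ell2_predP _ _ (near_a _ _ Fu0)).
pose A : ell2 R := u0 - d.
have AE n : A n = a n by rewrite /A/= subKr.
apply/cvg_ex; exists A; apply/cvgrPdist_le => e e0.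
have [u Fu] := Fc _ (divr_gt0 e0 (ltr0Sn R 1)).
have uA : `|u - A| <= e / 2.
  rewrite -(@ler_pXn2r _ 2)// ?nnegrE ?divr_ge0 ?(ltW e0)// ell2_normE.
  apply: ell2_dot_le => N; apply: le_trans (near_a _ _ Fu N).
  apply: ler_sum => n _; have -> : (u - A) n = u n - A n by [].
  by rewrite AE.
apply: filterS Fu => v; rewrite -ball_normE/= => /ltW uv.
rewrite -(subrKA u) (splitr e) (le_trans (ler_normD _ _))// lerD//.
by rewrite distrC.
Qed.

HB.instance Definition _ := Uniform_isComplete.Build (ell2 R) ell2_complete.

Lemma ell2_hilbert : is_hilbert (ell2 R).
Proof. by exists ell2_dot => u; rewrite ell2_normE. Qed.

End Ell2Dot.

(** * Weighted families of functionals *)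

Lemma ler_sum_subset {R : realType} {I : eqType} (s t : seq I) (g : I -> R) :
  uniq s -> uniq t -> {subset s <= t} -> (forall i, 0 <= g i) ->
  \sum_(i <- s) g i <= \sum_(i <- t) g i.
Proof.
move=> us ut st g0; have -> : \sum_(i <- s) g i = \sum_(i <- t | i \in s) g i.
  rewrite -[RHS]big_filter; apply: perm_big.
  apply: uniq_perm; rewrite ?filter_uniq// => i.
  by rewrite mem_filter; case: (boolP (i \in s)) => //= /st ->.
by rewrite [leRHS](bigID (mem s))/= lerDl sumr_ge0.
Qed.

(** Total on pairs, with zero weight past the end of a block, so that blocks of different sizes can
    be enumerated as a single sequence. *)
Definition block_weight {R : realType} (K : nat -> nat) (a : nat -> R)
    (p : nat * nat) : R :=
  if (p.2 < K p.1)%N then a p.1 / (K p.1)%:R else 0.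

Lemma block_weight_ge0 {R : realType} (K : nat -> nat) (a : nat -> R) p :
  (forall k, 0 <= a k) -> 0 <= block_weight K a p.
Proof. by move=> a0; rewrite /block_weight; case: ifP => // _; rewrite divr_ge0. Qed.

(** Any duplicate-free list is allowed because decoding the first [N] codes yields such a list. It
    is enlarged to the union [t] of the full blocks below [m]. *)
Lemma sum_block_weight_le {R : realType} (K : nat -> nat) (a : nat -> R)
    (M : R) (s : seq (nat * nat)) :
  (forall k, 0 <= a k) -> (forall N, \sum_(0 <= k < N) a k <= M) -> uniq s ->
  \sum_(p <- s) block_weight K a p <= M.
Proof.
move=> a0 aM us; pose m := (\max_(p <- s) p.1).+1.
rewrite -big_mkcond/= -big_filter.
pose t := [seq (k, i) | k <- iota 0 m, i <- iota 0 (K k)].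
apply: le_trans (_ : \sum_(p <- t) a p.1 / (K p.1)%:R <= _).
  apply: ler_sum_subset => [||[k i]|p]; rewrite ?filter_uniq ?divr_ge0//.
    by apply: allpairs_uniq_dep => [|k _|[k i] [l j] _ _ [-> ->]//];
      exact: iota_uniq.
  rewrite mem_filter/= => /andP[iK ks]; apply/allpairsPdep; exists k, i.
  rewrite !mem_iota/= !add0n ltnS; split=> //.
  exact: (@leq_bigmax_seq _ s xpredT (fun p => p.1) (k, i) ks isT).
rewrite /t big_allpairs_dep/=; apply: le_trans (aM m).
rewrite /index_iota subn0; apply: ler_sum => k _.
rewrite big_const_seq count_predT size_iota iter_addr_0.
rewrite -[leLHS]mulr_natr -mulrA.
(* An empty block contributes nothing, any other exactly [a k]. *)
have [->|K0] := eqVneq (K k) 0%N; first by rewrite mulr0 mulr0 a0.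
by rewrite mulVf ?mulr1// pnatr_eq0.
Qed.

Lemma ell2_embedding {R : realType} {B : normedModType R}
    (f : nat -> {scalar B}) (w : nat -> R) :
  (forall n x, `|f n x| <= `|x|) -> (forall n, 0 <= w n) ->
  (forall N, \sum_(0 <= n < N) w n <= 1) ->
  exists Phi : {linear B -> ell2 R}, (forall x, `|Phi x| <= `|x|) /\
    (forall n x, w n * f n x ^+ 2 <= `|Phi x| ^+ 2).
Proof.
move=> f1 w0 w1; pose g x n := Num.sqrt (w n) * f n x.
have g2 x n : g x n ^+ 2 = w n * f n x ^+ 2 by rewrite exprMn sqr_sqrtr.
have gub x N : \sum_(0 <= n < N) g x n ^+ 2 <= `|x| ^+ 2.
  apply: (@le_trans _ _ (\sum_(0 <= n < N) w n * `|x| ^+ 2)).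
    apply: ler_sum => n _; rewrite g2 ler_wpM2l// -real_normK ?num_real//.
    by rewrite ler_pXn2r// nnegrE.
  by rewrite -mulr_suml ler_piMl// sqr_ge0.
pose Phi0 x : ell2 R := Ell2 R (g x) (ell2_predP _ _ (gub x)).
have linPhi : linear Phi0.
  move=> c x y; apply/val_inj/funext => n /=.
  rewrite /g linearP mulrDr mulrCA; reflexivity.
pose Phi : {linear B -> ell2 R} :=
  HB.pack Phi0 (GRing.isLinear.Build R B (ell2 R) *:%R Phi0 linPhi).
exists Phi; split=> [x|n x].
  rewrite -(@ler_pXn2r _ 2)// ?nnegrE// ell2_normE; apply: ell2_dot_le.
  exact: gub.
by rewrite -g2 ell2_normE; exact: (ell2_sqr_le (Phi0 x) n).
Qed.

Lemma block_embedding {R : realType} {B : normedModType R}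
    (f : nat -> nat -> {scalar B}) (K : nat -> nat) (a : nat -> R) :
  (forall k i x, `|f k i x| <= `|x|) -> (forall k, 0 <= a k) ->
  (forall N, \sum_(0 <= k < N) a k <= 1) ->
  exists Phi : {linear B -> ell2 R}, (forall x, `|Phi x| <= `|x|) /\
    (forall k i x, (i < K k)%N ->
      a k / (K k)%:R * f k i x ^+ 2 <= `|Phi x| ^+ 2).
Proof.
(* [pickle_inv] decodes each pair from exactly one code, so no weight is counted twice. Numbers that
   code no pair get weight [0], with [f 0 0] as a filler. *)
move=> f1 a0 a1; pose h n : option (nat * nat) := pickle_inv n.
pose F n := oapp (fun p : nat * nat => f p.1 p.2) (f 0 0) (h n).
pose w n := oapp (block_weight K a) 0 (h n).
have [| | |Phi [Phi1 Phiw]] := ell2_embedding F w.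
- by move=> n x; rewrite /F; case: (h n) => [[k i]|] /=.
- by move=> n; rewrite /w; case: (h n) => //= p; exact: block_weight_ge0.
- move=> N; rewrite /w -(big_pmap h); apply: sum_block_weight_le => //.
  by rewrite (pmap_uniq pickle_invK)// iota_uniq.
exists Phi; split=> // k i x iK; have := Phiw (pickle (k, i)) x.
by rewrite /F /w /h pickleK_inv/= /block_weight/= iK.
Qed.

(** * Telescoping weights of polynomial decay *)

Section TelescopingWeights.
Context {R : realType} (q : R) (q0 : 0 < q).

Definition tele_weight (k : nat) : R := k.+1%:R `^ (- q) - k.+2%:R `^ (- q).

Lemma sum_tele_weight_le1 N : \sum_(0 <= k < N) tele_weight k <= 1.
Proof.
have -> : \sum_(0 <= k < N) tele_weight k = 1 - N.+1%:R `^ (- q).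
  elim: N => [|N IH]; first by rewrite big_geq// powR1 subrr.
  by rewrite big_nat_recr//= IH /tele_weight addrA subrK.
by rewrite gerBl powR_ge0.
Qed.

(* [k.+1 `^ (- q)] is [k.+2 `^ (- q)] times [expR (q * ln (k.+2 / k.+1))], which
   is at least [1 + q / k.+2]. *)
Lemma tele_weight_ge k : q * k.+2%:R `^ (- q - 1) <= tele_weight k.
Proof.
have k1 : 0 < k.+1%:R :> R by [].
have k2 : 0 < k.+2%:R :> R by [].
set m := k.+2%:R in k2 *; set l := k.+1%:R in k1 *.
have lm : l = m - 1 by rewrite /l /m [k.+2%:R]mulrSr addrK.
have d : m^-1 <= ln m - ln l.
  have lmm : 0 < l / m by rewrite divr_gt0.
  have -> : ln m - ln l = - ln (l / m).
    by rewrite lnM ?posrE ?invr_gt0// lnV ?posrE// opprD opprK addrC.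
  rewrite lerNr; have -> : l / m = 1 + - m^-1.
    by rewrite lm mulrBl mulfV ?gt_eqF// mul1r.
  by apply: le_ln1Dx; rewrite ltrN2 invf_lt1 ?ltr1n.
rewrite powRD; last by rewrite (gt_eqF k2) implybT.
rewrite powR_inv1 ?(ltW k2)// /tele_weight -/m -/l.
have -> : l `^ (- q) = m `^ (- q) * expR (q * (ln m - ln l)).
  rewrite /powR !gt_eqF// -expRD; congr expR; ring.
have := expR_ge1Dx (q * (ln m - ln l)) => h.
have h2 : 1 + q * m^-1 <= expR (q * (ln m - ln l)).
  by apply: le_trans h; rewrite lerD2l ler_pM2l.
have p0 := powR_ge0 m (- q).
by have := ler_wpM2l p0 h2; rewrite mulrDr mulr1 mulrCA lerBrDl.
Qed.

Lemma tele_weight_ge0 k : 0 <= tele_weight k.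
Proof.
by apply: le_trans (tele_weight_ge k); rewrite mulr_ge0 ?powR_ge0// ltW.
Qed.

End TelescopingWeights.

(** * Dyadic estimates *)

Section Slog.
Context {R : realType}.
Implicit Types x D : R.

Lemma slog_le x y : 0 < x -> x + x^-1 <= y -> slog x <= ln y.
Proof.
move=> x0 xy; have px : 0 < x + x^-1 by rewrite addr_gt0 ?invr_gt0.
by rewrite /slog ler_ln// posrE// (lt_le_trans px).
Qed.

Lemma slog_ge x y : 0 < x -> 0 < y -> y <= x + x^-1 -> ln y <= slog x.
Proof.
move=> x0 y0 yx; have px : 0 < x + x^-1 by rewrite addr_gt0 ?invr_gt0.
by rewrite /slog ler_ln// posrE.
Qed.

Lemma ln2_gt0 : 0 < ln (2 : R).
Proof. by rewrite ln_gt0// ltr1n. Qed.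

(** Since [x + x^-1 - 2 = (x - 1) ^+ 2 / x]. This keeps [slog] away from zero, so that additive
    constants can be absorbed into multiples of it. *)
Lemma slog_ge_ln2 x : 0 < x -> ln 2 <= slog x.
Proof.
move=> x0; apply: slog_ge => //; have := sqr_ge0 (x - 1).
have xx : x * x^-1 = 1 by rewrite mulfV// gt_eqF.
have xi : 0 < x^-1 by rewrite invr_gt0.
move=> /(mulr_ge0 (ltW xi)).
have -> : x^-1 * (x - 1) ^+ 2 = x * (x * x^-1) - 2 * (x * x^-1) + x^-1 by ring.
by rewrite xx; lra.
Qed.

Lemma slog_gt0 x : 0 < x -> 0 < slog x.
Proof. by move=> /slog_ge_ln2; apply: lt_le_trans ln2_gt0. Qed.

(** The sum [x + x^-1] is at most [(D + 8) * 2 ^+ k]. The factor [8] lets the bound cover both radii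
    [D / 2 ^+ k] and [D / 2 ^+ k / 8]; [k.+2] replaces [k] to stay positive at [k = 0]. *)
Lemma slog_dyadic_le D x k : 1 <= D -> 0 < x -> x <= D ->
  x^-1 <= 8 * 2 ^+ k -> slog x <= (ln (D + 8) + ln 2) * k.+2%:R.
Proof.
move=> D1 x0 xD xk.
have D8 : 0 < D + 8 by lra.
have k2 : 1 <= 2 ^+ k :> R by rewrite exprn_ege1// ler1n.
have h : slog x <= ln ((D + 8) * 2 ^+ k).
  by apply: slog_le => //; nra.
apply: le_trans h _; rewrite lnM ?posrE ?exprn_gt0// lnXn// -[ln 2 *+ k]mulr_natr.
have l0 : 0 <= ln (D + 8) by rewrite ln_ge0//; lra.
have l2 := ln2_gt0; have kl := mulr_ge0 l0 (ler0n R k).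
by rewrite -(addn2 k) [(k + 2)%:R]natrD; lra.
Qed.

(** From [x^-1 >= 2 ^+ k / D] one gets [k * ln 2 <= slog x + ln D]; the remaining constant
    [ln D + 2 * ln 2] is absorbed by [slog x >= ln 2]. *)
Lemma slog_dyadic_ge D x k : 1 <= D -> 0 < x -> x <= D / 2 ^+ k ->
  k.+2%:R <= (1 + (ln D + 2 * ln 2) / ln 2) / ln 2 * slog x.
Proof.
move=> D1 x0 xk.
have D0 : 0 < D by lra.
have l2 := ln2_gt0; have s2 := slog_ge_ln2 x x0.
have lD : 0 <= ln D by rewrite ln_ge0.
have k0 : 0 < 2 ^+ k :> R by rewrite exprn_gt0.
have h : ln (2 ^+ k / D) <= slog x.
  apply: slog_ge; rewrite ?divr_gt0//.
  apply: le_trans (_ : x^-1 <= _); last by rewrite lerDr ltW.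
  by rewrite -[2 ^+ k / D]invf_div lef_pV2// posrE divr_gt0.
rewrite lnM ?posrE ?invr_gt0// lnV ?posrE// lnXn// -[ln 2 *+ k]mulr_natr in h.
rewrite mulrAC ler_pdivlMr//.
have h2 : ln D + 2 * ln 2 <= (ln D + 2 * ln 2) / ln 2 * slog x.
  rewrite mulrAC ler_pdivlMr// ler_pM2l//; lra.
by rewrite -(addn2 k) [(k + 2)%:R]natrD; nra.
Qed.

End Slog.

(** Take the least [k] satisfying the second inequality: its failure at [k - 1] is the first one,
    and for [k = 0] the first is [x <= D]. *)
Lemma dyadic_scale {R : realType} (D x : R) : 0 < x -> x <= D ->
  exists k : nat, x <= D / 2 ^+ k /\ D / 2 ^+ k < 2 * x.
Proof.
move=> x0 xD; have D0 : 0 < D by exact: lt_le_trans xD.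
have k0 k : 0 < 2 ^+ k :> R by rewrite exprn_gt0.
have exk : exists k : nat, D / 2 ^+ k < 2 * x.
  exists (Num.bound (D / (2 * x))); rewrite ltr_pdivrMr// mulrC -ltr_pdivrMr ?mulr_gt0//.
  apply: lt_trans (archi_boundP _) _; first by rewrite ltW// divr_gt0// mulr_gt0.
  by rewrite -natrX ltr_nat ltn_expl.
exists (ex_minn exk); case: ex_minnP => -[|k] Pk mink; split=> //.
  by rewrite expr0 divr1.
have : 2 * x <= D / 2 ^+ k by rewrite leNgt; apply/negP => /mink; rewrite ltnn.
by rewrite exprS invfM mulrCA; lra.
Qed.

(** Here [n] is the level [k.+2], [S] is [slog] of the distance, [a] the weight and [K] the size of
    the block. The chain is [a / K >= q / M * n]^ (- d) >= q / M * (E * S) [^ (- d)]. *)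
Lemma powR_ratio_ge {R : realType} (q ab d M E S n a K : R) :
  0 <= d -> d = q + 1 + ab -> 0 < q -> 0 < M -> 0 < E -> 0 < S -> 0 < n -> 0 < K ->
  n <= E * S -> K <= M * n `^ ab -> q * n `^ (- q - 1) <= a ->
  q / M / E `^ d / S `^ d <= a / K.
Proof.
move=> d0 dE q0 M0 E0 S0 n0 K0 nES KM qa.
have nd := powR_gt0 d n0; have nab := powR_gt0 ab n0.
have a0 : 0 <= a by apply: le_trans qa; rewrite mulr_ge0 ?powR_ge0// ltW.
apply: (@le_trans _ _ (q / M / n `^ d)).
  rewrite -mulrA -invfM -powRM ?(ltW E0) ?(ltW S0)//.
  rewrite ler_pM2l ?divr_gt0// lef_pV2 ?posrE//; last by rewrite powR_gt0// mulr_gt0.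
  by rewrite ge0_ler_powR// nnegrE ltW// mulr_gt0.
apply: (@le_trans _ _ (a / (M * n `^ ab))).
  apply: le_trans (_ : q * n `^ (- q - 1) / (M * n `^ ab) <= _); last first.
    by rewrite ler_pM2r// invr_gt0 mulr_gt0.
  have -> : - q - 1 = - d + ab by rewrite dE; ring.
  rewrite powRD; last by rewrite (gt_eqF n0) implybT.
  rewrite powRN le_eqVlt; apply/orP; left; apply/eqP; field.
  by rewrite !gt_eqF.
by rewrite ler_wpM2l// lef_pV2// posrE mulr_gt0.
Qed.

(** Homogeneity is used at radii of fixed ratio [8], so the power [s] costs only a constant, and
    both [slog] factors are of order [k.+2]. *)
Lemma dyadic_net {R : realType} {V : normedModType R} (alpha beta D M s : R)
    (Z : set V) (k : nat) :
  0 <= alpha -> 0 <= beta -> 1 <= D -> 0 < M ->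
  almost_Ms_homogeneous_at0 alpha beta M s Z ->
  exists Kz : nat * (nat -> V),
    (forall x, Z x -> `|x| <= D / 2 ^+ k ->
      exists2 i, (i < Kz.1)%N & `|Kz.2 i - x| <= D / 2 ^+ k / 8) /\
    Kz.1%:R <= M * 8 `^ s * (ln (D + 8) + ln 2) `^ (alpha + beta) *
      k.+2%:R `^ (alpha + beta).
Proof.
move=> alpha0 beta0 D1 M0 hZ.
have D0 : 0 < D by lra.
have k0 : 0 < 2 ^+ k :> R by rewrite exprn_gt0.
have k1 : 1 <= 2 ^+ k :> R by rewrite exprn_ege1// ler1n.
set r := D / 2 ^+ k; have r0 : 0 < r by rewrite divr_gt0.
have rD : r <= D by rewrite ler_pdivrMr// ler_peMr// ltW.
have rV : r^-1 <= 2 ^+ k by rewrite invf_div ler_pdivrMr// ler_peMr// ltW.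
have [||K [z [_ zcov Kle]]] := hZ r (r / 8); [by lra..|].
(* The centres are extended by [0] to a sequence, and paired with their number so that one use of
   [choice] selects the nets of all levels. *)
exists (K, fun i => oapp z 0 (insub i)); split=> /= [x Zx xr|].
  have [|i _ /= ix] := zcov x; first by split=> //; rewrite /closed_ball_/= sub0r normrN.
  by exists (val i); rewrite ?valK//= ltn_ord.
apply: le_trans Kle _; have -> : r / (r / 8) = 8.
  by rewrite invf_div mulrCA mulfV ?mulr1// gt_eqF.
set A := ln (D + 8) + ln 2.
have A0 : 0 < A by rewrite ltr_wpDl ?ln2_gt0// ln_ge0//; lra.
have A2 : 0 < A * k.+2%:R by rewrite mulr_gt0.
have sr : slog r <= A * k.+2%:R by apply: slog_dyadic_le => //; lra.
have srho : slog (r / 8) <= A * k.+2%:R.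
  by apply: slog_dyadic_le => //; [lra|lra|rewrite invf_div ler_pM2l].
have s1 := slog_gt0 _ r0; have s2 : 0 < slog (r / 8) by apply: slog_gt0; lra.
have h : slog r `^ alpha * slog (r / 8) `^ beta <=
    A `^ (alpha + beta) * k.+2%:R `^ (alpha + beta).
  rewrite -powRM ?(ltW A0)// powRD; last by rewrite (gt_eqF A2) implybT.
  apply: ler_pM; rewrite ?powR_ge0//;
    by apply: ge0_ler_powR; rewrite // nnegrE ltW.
have c0 : 0 <= M * 8 `^ s by rewrite mulr_ge0 ?powR_ge0// ltW.
by have := ler_wpM2l c0 h; rewrite !mulrA.
Qed.

(** * Assembling nets, functionals and weights into the embedding *)

Theorem theorem2p5 (R : realType) (alpha beta : R)
    (halpha : 0 <= alpha) (hbeta : 0 <= beta)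
    (B : completeNormedModType R) (X : set B) (hX : compact X)
    (hXX : almost_homogeneous_at0 alpha beta (difference_set X))
    (delta : R) (hdelta : (1 + alpha + beta) / 2 < delta) :
  exists (H : completeNormedModType R) (Phi : {linear B -> H}),
    [/\ is_hilbert H, bounded_linear Phi
      & exists2 C : R, 0 < C &
          forall x y : B, X x -> X y -> x <> y ->
            C^-1 * (`|x - y| / slog `|x - y| `^ delta) <= `|Phi x - Phi y|
            /\ `|Phi x - Phi y| <= `|x - y|].
Proof.
have [M [s [M0 _ hZ]]] := hXX.
have [D D1 XD] : exists2 D : R, 1 <= D &
    forall x y, X x -> X y -> `|x - y| <= D.
  have [N [_ XN]] := compact_bounded hX.
  have N1 : N < `|N| + 1 by rewrite ltr_pwDr// ler_norm.
  exists (2 * (`|N| + 1)); first by have := normr_ge0 N; lra.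
  move=> x y /(XN _ N1)/= xN /(XN _ N1)/= yN.
  by rewrite (le_trans (ler_normB _ _))//; lra.
(* Thus [q + 1 + alpha + beta = 2 * delta], and [hdelta] says exactly that [q > 0]. *)
pose q := 2 * delta - (1 + alpha + beta).
have q0 : 0 < q by rewrite /q; lra.
have [Kz Kzp] := choice (fun k => dyadic_net _ _ _ _ _ _ k halpha hbeta D1 M0 hZ).
have [F Fp] := choice (@norming_functional R B).
have [| | |Phi [Phi1 Phi2]] := block_embedding (fun k i => F ((Kz k).2 i))
  (fun k => (Kz k).1) (tele_weight q).
- by move=> k i x; exact: (Fp _).1.
- exact: tele_weight_ge0.
- exact: sum_tele_weight_le1.
exists (ell2 R : completeNormedModType R), Phi; split.
- exact: ell2_hilbert.
- by exists 1 => x; rewrite mul1r.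
pose M' := M * 8 `^ s * (ln (D + 8) + ln 2) `^ (alpha + beta).
have l2 : 0 < ln (2 : R) := ln2_gt0.
have M'0 : 0 < M'.
  by rewrite /M' !mulr_gt0 ?powR_gt0// ltr_wpDl// ln_ge0//; lra.
pose E := (1 + (ln D + 2 * ln 2) / ln 2) / ln 2.
have E0 : 0 < E.
  have lD : 0 <= ln D by rewrite ln_ge0.
  by rewrite divr_gt0// ltr_pwDl// divr_ge0//; lra.
(* The [4] pays for the square of the loss in [|f z| >= |z| / 2]. *)
pose c := q / M' / E `^ (2 * delta) / 4.
have c0 : 0 < c by rewrite !divr_gt0// powR_gt0.
exists (Num.sqrt c)^-1; first by rewrite invr_gt0 sqrtr_gt0.
move=> x y Xx Xy xy; rewrite -linearB invrK; split; last exact: Phi1.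
set z := x - y.
have z0 : 0 < `|z| by rewrite normr_gt0 subr_eq0; apply/eqP.
have [k [zk kz]] := dyadic_scale D `|z| z0 (XD _ _ Xx Xy).
have Zz : difference_set X z by exists x => //; exists y.
have [/(_ z Zz zk)[i iK zi] Kle] := Kzp k.
have [F1 Fi] := Fp ((Kz k).2 i).
set f := F ((Kz k).2 i) in F1 Fi.
(* With [v] the centre and [r = D / 2 ^+ k], [f z >= |v| - |v - z| >= |z| - 2 * (r / 8)], and
   [r < 2 * |z|]; this is why the radius is an eighth. *)
have fz : `|z| / 2 <= `|f z|.
  have h1 := le_trans (ler_norm _) (F1 ((Kz k).2 i - z)).
  rewrite linearB Fi in h1.
  have h2 : `|z| <= `|(Kz k).2 i - z| + `|(Kz k).2 i|.
    have := ler_normB ((Kz k).2 i) ((Kz k).2 i - z).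
    by rewrite subKr addrC.
  by have := ler_norm (f z); lra.
have K0 : 0 < (Kz k).1%:R :> R by rewrite ltr0n (leq_ltn_trans _ iK).
have S0 := slog_gt0 _ z0; set S := slog `|z| in S0 *.
have := powR_ratio_ge q (alpha + beta) (2 * delta) M' E S k.+2%:R
  (tele_weight q k) (Kz k).1%:R.
move=> /(_ _ _ q0 M'0 E0 S0 _ K0) h.
have {h} : 4 * c / S `^ (2 * delta) <= tele_weight q k / (Kz k).1%:R.
  have -> : 4 * c = q / M' / E `^ (2 * delta)
    by rewrite /c; field; rewrite ?gt_eqF ?powR_gt0.
  apply: h => //; first by lra.
  - by rewrite /q; ring.
  - exact: slog_dyadic_ge.
  - exact: tele_weight_ge.
move=> h; have := Phi2 k i z iK; rewrite -/f => h2.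
rewrite -(@ler_pXn2r _ 2)// ?nnegrE ?mulr_ge0 ?sqrtr_ge0 ?invr_ge0 ?powR_ge0//.
apply: le_trans h2; rewrite exprMn sqr_sqrtr ?(ltW c0)// expr_div_n.
have -> : (S `^ delta) ^+ 2 = S `^ (2 * delta).
  by rewrite mulr_natl mulr2n powRD ?(gt_eqF S0) ?implybT.
apply: le_trans (_ : 4 * c / S `^ (2 * delta) * (`|z| / 2) ^+ 2 <= _).
  by rewrite le_eqVlt; apply/orP; left; apply/eqP; field; rewrite gt_eqF ?powR_gt0.
have cS : 0 <= 4 * c / S `^ (2 * delta).
  by rewrite divr_ge0 ?powR_ge0// mulr_ge0// ltW.
apply: ler_pM; rewrite ?sqr_ge0//.
by rewrite -[leRHS]real_normK ?num_real// ler_pXn2r// nnegrE divr_ge0.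
Qed.
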